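(* Let $k$ be a field, $m\geqslant 1$, let $r_1,\ldots,r_m$ be integers with $r_i>1$ for all $i$, and let $C:=k[X_1,\ldots,X_m]$. Let $$H(X_{1}, \ldots , X_{m},Z,T)=a_{0}(Z)+a_{1}(Z)T+\widetilde{H}(X_{1}, \ldots , X_{m},Z),$$ where $a_0,a_1\in k[Z]$, $a_0(Z)+a_1(Z)T\neq 0$, and $\widetilde{H} \in (X_1,\ldots,X_m)C[Z]$, and let $A$ be the affine domain $$A= \frac{k[ X_{1}, \ldots , X_{m}, Y,Z,T]}{(X_{1}^{r_{1}} \cdots X_{m}^{r_{m}}Y -H(X_{1}, \ldots , X_{m}, Z,T))}.$$ Then $\operatorname{DK}(A)=A$ and $\operatorname{ML}(A)=k$ when any one of the following holds: (i) $a_1(Z)\neq 0$. (ii) $a_1(Z)=0$, $H$ is a monic polynomial in $Z$ and $(H,H_Z)=C[Z]$.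
   Context: For $f=\sum_{i=0}^n c_iW^i\in R[W]$ over a ring $R$, $f_W:=\sum_{i=1}^n i c_iW^{i-1}$; thus $H_Z$ is the formal derivative of $H\in C[Z]$ with respect to $Z$, and $(H,H_Z)$ is the ideal of $C[Z]$ generated by $H$ and $H_Z$. For a ring $R$, $R^{[n]}$ denotes a polynomial ring in $n$ variables over $R$. An exponential map on a $k$-algebra $B$ is a $k$-algebra homomorphism $\phi: B\to B^{[1]}$ such that, writing $\phi_U: B\to B[U]$ for $\phi$ with an indeterminate $U$: (1) $\epsilon_0\phi_U=\mathrm{id}_B$, where $\epsilon_0:B[U]\to B$ is evaluation at $U=0$; (2) $\phi_V\phi_U=\phi_{U+V}$, where $\phi_V: B\to B[V]$ is extended to $\phi_V:B[U]\to B[U,V]$ by $\phi_V(U)=U$. Its ring of invariants is $B^\phi=\{b\in B: \phi(b)=b\}$. $\mathrm{EXP}(B)$ is the set of all exponential maps on $B$. The Makar-Limanov invariant is $\operatorname{ML}(B)=\bigcap_{\phi\in \mathrm{EXP}(B)}B^\phi$, and the Derksen invariant $\operatorname{DK}(B)$ is the $k$-subalgebra of $B$ generated by all $b\in B^\phi$ with $\phi\in\mathrm{EXP}(B)$ and $B^\phi\subsetneq B$.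
   Formalization: In (ii), H is additionally required to have positive degree in Z; this excludes only H = 1, for which A = k[X_1^{±1},…,X_m^{±1},Z,T] has the non-constant units X_i in ML(A), so that ML(A) ≠ k. *)

(* Defs.v *)
From HB Require Import structures.
From mathcomp Require Import all_boot all_order all_algebra ring_quotient.
From mathcomp Require Import boolp classical_sets.
From mathcomp Require Import mpoly.

Set Implicit Arguments.
Unset Strict Implicit.
Unset Printing Implicit Defensive.

Import GRing.Theory.

Local Open Scope ring_scope.
Local Open Scope classical_set_scope.
Local Open Scope quotient_scope.

(* The ideal generated by the entries of s. *)
Definition ideal_gen (R : comNzRingType) (s : seq R) : set R :=
  [set x | exists c : nat -> R, x = \sum_(i < size s) c i * s`_i].

Section QuotientAlgebra.
Variables (k : fieldType) (R : comAlgType k) (I : idealr R).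

Definition quot_scale (c : k) (x : {ideal_quot I}) : {ideal_quot I} :=
  \pi_({ideal_quot I}) (c%:A) * x.

Fact quot_scaleA (a b : k) (x : {ideal_quot I}) :
  quot_scale a (quot_scale b x) = quot_scale (a * b) x.
Proof. by rewrite /quot_scale mulrA -rmorphM /= -scalerAl mul1r scalerA. Qed.

Fact quot_scale1 : left_id 1 quot_scale.
Proof. by move=> x; rewrite /quot_scale scale1r rmorph1 mul1r. Qed.

Fact quot_scaleDr : right_distributive quot_scale +%R.
Proof. by move=> c x y; rewrite /quot_scale mulrDr. Qed.

Fact quot_scaleDl (x : {ideal_quot I}) :
  {morph quot_scale^~ x : a b / a + b}.
Proof. by move=> a b; rewrite /quot_scale scalerDl rmorphD mulrDl. Qed.

HB.instance Definition _ := GRing.Zmodule_isLmodule.Build k {ideal_quot I}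
  quot_scaleA quot_scale1 quot_scaleDr quot_scaleDl.

Fact quot_scaleAl (c : k) (x y : {ideal_quot I}) : c *: (x * y) = c *: x * y.
Proof. exact: mulrA. Qed.

HB.instance Definition _ :=
  GRing.Lmodule_isLalgebra.Build k {ideal_quot I} quot_scaleAl.
HB.instance Definition _ :=
  GRing.Lalgebra_isComAlgebra.Build k {ideal_quot I}.

End QuotientAlgebra.

Section ExponentialMaps.
Variables (k : fieldType) (B : comAlgType k).

(* k-algebra morphisms B -> B[U]; since the library makes {poly B} an algebra  *)
(* over B only, k acts on it through k -> B.                                   *)
Definition alg_to_poly : Type :=
  {lrmorphism B -> {poly B} | GRing.in_alg B \; *:%R}.

Identity Coercion lrmorphism_of_alg_to_poly :
  alg_to_poly >-> GRing.LRMorphism.type.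

(* In {poly {poly B}} = B[V][U] the outer variable is U and the inner one V:   *)
(* map_poly phi extends phi_V to B[U] by U |-> U, and                          *)
(* poly_XaY p = p(U + V).                                                      *)
Definition EXP : set alg_to_poly :=
  [set phi | (forall b, (phi b).[0] = b) /\
             (forall b, map_poly phi (phi b) = poly_XaY (phi b))].

Definition invariants (phi : alg_to_poly) : set B :=
  [set b | phi b = b%:P].

Definition ML : set B := \bigcap_(phi in EXP) invariants phi.

Definition DK : set B :=
  smallest (fun S : set B => GRing.subalg_closed (mem S))
    (\bigcup_(phi in [set phi | EXP phi /\ invariants phi `<` [set: B]])
       invariants phi).

End ExponentialMaps.

Arguments EXP {k} B.
Arguments ML {k} B.
Arguments DK {k} B.

Section Hypersurface.
Variables (k : fieldType) (m : nat).

(* k[X_1, ..., X_m, Y, Z, T], with variables in this order. *)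
Local Notation P := {mpoly k[m + 3]}.

Definition varX (i : 'I_m) : P := 'X_(lshift 3 i).
Definition varY : P := 'X_(rshift m (@Ordinal 3 0 isT)).
Definition varZ : P := 'X_(rshift m (@Ordinal 3 1 isT)).
Definition varT : P := 'X_(rshift m (@Ordinal 3 2 isT)).

Definition embC (p : {mpoly k[m]}) : P := p \mPo [tuple varX i | i < m].

Definition embCZ (p : {poly {mpoly k[m]}}) : P := (map_poly embC p).[varZ].

(* {poly {poly {mpoly k[m]}}} = C[Z][T]: the inner variable is Z, the outer T. *)
Definition embCZT (H : {poly {poly {mpoly k[m]}}}) : P :=
  (map_poly embCZ H).[varT].

Variables (r : 'I_m -> nat) (H : {poly {poly {mpoly k[m]}}}).

Definition hyp_eqn : P := (\prod_(i < m) varX i ^+ r i) * varY - embCZT H.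

Definition hyp_ideal : {pred P} := [pred p | `[< ideal_gen [:: hyp_eqn] p >]].

Lemma hyp_idealP p : reflect (exists c, p = c * hyp_eqn) (p \in hyp_ideal).
Proof.
apply: (iffP (asboolP _)) => [[c ->]|[c ->]].
  by exists (c 0%N); rewrite big_ord1.
by exists (fun=> c); rewrite big_ord1.
Qed.

Lemma meval_embC v (p : {mpoly k[m]}) :
  (embC p).@[v] = p.@[fun i => v (lshift 3 i)].
Proof.
rewrite /embC comp_mpoly_meval; apply: meval_eq => i.
by rewrite !tnth_mktuple mevalXU.
Qed.

Lemma meval_embCZT v w : (forall i, v (lshift 3 i) = w (lshift 3 i)) ->
  v (rshift m (@Ordinal 3 1 isT)) = w (rshift m (@Ordinal 3 1 isT)) ->
  v (rshift m (@Ordinal 3 2 isT)) = w (rshift m (@Ordinal 3 2 isT)) ->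
  (embCZT H).@[v] = (embCZT H).@[w].
Proof.
move=> eX eZ eT.
have eC (p : {mpoly k[m]}) : (embC p).@[v] = (embC p).@[w].
  by rewrite !meval_embC; apply: meval_eq => i; exact: eX.
have eCZ p : (embCZ p).@[v] = (embCZ p).@[w].
  rewrite /embCZ !horner_poly !raddf_sum /=; apply: eq_bigr => i _.
  by rewrite !mevalM !rmorphXn /= !mevalXU eC eZ.
rewrite /embCZT !horner_poly !raddf_sum /=; apply: eq_bigr => i _.
by rewrite !mevalM !rmorphXn /= !mevalXU eCZ eT.
Qed.

(* The equation vanishes at a point with all X_i = 1, so it is not a unit. *)
Fact hyp_ideal_closed : idealr_closed hyp_ideal.
Proof.
split; first by apply/hyp_idealP; exists 0; rewrite mul0r.
- apply/hyp_idealP => -[q q1].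
  pose v (y : k) (i : 'I_(m + 3)) := match split i with
    | inl _ => 1 | inr j => if j == 0%N :> nat then y else 0 end.
  have vX y i : v y (lshift 3 i) = 1.
    by rewrite /v -[lshift 3 i]/(unsplit (inl i)) unsplitK.
  have vR y j : v y (rshift m j) = if j == 0%N :> nat then y else 0.
    by rewrite /v -[rshift m j]/(unsplit (inr j)) unsplitK.
  pose c := (embCZT H).@[v 0].
  have := congr1 (meval (v c)) q1.
  rewrite meval1 mevalM mevalB mevalM rmorph_prod /=.
  rewrite big1 => [|i _]; last by rewrite rmorphXn /= mevalXU vX expr1n.
  rewrite mevalXU vR /= mul1r (@meval_embCZT (v c) (v 0)) ?vR //.
    by rewrite subrr mulr0 => /eqP; rewrite oner_eq0.
  by move=> i; rewrite !vX.
- move=> a _ _ /hyp_idealP[p ->] /hyp_idealP[q ->]; apply/hyp_idealP.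
  by exists (a * p + q); rewrite mulrDl mulrA.
Qed.

HB.instance Definition _ := isIdealr.Build P hyp_ideal hyp_ideal_closed.

Definition hyp_alg : Type := {ideal_quot hyp_ideal}.

HB.instance Definition _ := GRing.ComAlgebra.on hyp_alg.

End Hypersurface.

(* Main.v *)
(* Write X^r for the product of the X_i^(r_i). Elements of A are polynomials in
   X, Z, T after multiplication by a power of X^r, and A is a domain. Two
   exponential maps always exist: Z |-> Z + X^r U fixing X, T, and
   T |-> T + X^r U fixing X, Z, the image of Y being dictated by the equation.
   If for every i some exponential map moves X_i and fixes the other X_j, then
   ML(A) = k: when f is invariant and X^(rN) f = p(X, Z, T), the images of T, Z
   and X_i are transcendental over A, so that the equality persists when T, Z
   are specialised to 0 and then each X_i to 1, which gives f = p(1, 0, 0).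
   (i) If a1 is nonzero, X_i |-> X_i + a1(Z) U with Y, Z fixed is such a map; it
   also puts Y into DK(A).
   (ii) If a1 = 0, the second map fixes Y. With a H + b H_Z = 1, Danielewski's
   trick replaces r_i >= 2 by r_i - 1 without changing A: with d = X^r / X_i the
   new generators are s = Z + d T, y1 = H(s) / d and v = (T - b(s) y1) / X_i.
   When r_i = 1, write H = h0 + X_i h1 with h0 free of X_i, X' = X^r / X_i and
   u = X' Y - h1. Then X_i u = h0(Z), so that Z |-> Z + u X' U with u fixed
   extends to an exponential map moving X_i. *)

Require Import Defs.
From HB Require Import structures.
From mathcomp Require Import all_boot all_order all_algebra ring_quotient.
From mathcomp Require Import boolp classical_sets.
From mathcomp Require Import mpoly ring.

Set Implicit Arguments.
Unset Strict Implicit.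
Unset Printing Implicit Defensive.

Import GRing.Theory.

Local Open Scope ring_scope.
Local Open Scope classical_set_scope.

(** * Evaluation of polynomials over C[Z] *)

Lemma mpoly_gen_ind (n : nat) (R : nzRingType) (Q : {mpoly R[n]} -> Prop) :
  (forall c, Q c%:MP) -> (forall p q, Q p -> Q q -> Q (p + q)) ->
  (forall p q, Q p -> Q q -> Q (p * q)) -> (forall i, Q 'X_i) ->
  forall p, Q p.
Proof.
move=> QC QD QM QX; apply: mpolyind => [|c mm p _ _ Qp].
  by rewrite -mpolyC0.
apply: (QD) => //; rewrite -mul_mpolyC; apply: (QM) => //.
rewrite mpolyXE_id; apply: (big_ind Q) => [||i _]; [exact: QC|exact: QM|].
elim: (mm i) => [|e IHe]; first by rewrite expr0; exact: QC.
by rewrite exprS; exact: QM.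
Qed.

Lemma poly_gen_ind (R : nzRingType) (Q : {poly R} -> Prop) :
  (forall c, Q c%:P) -> (forall p q, Q p -> Q q -> Q (p + q)) ->
  (forall p q, Q p -> Q q -> Q (p * q)) -> Q 'X ->
  forall p, Q p.
Proof.
move=> QC QD QM QX; elim/poly_ind => [|p c Qp]; first by rewrite -polyC0.
by apply: (QD) => //; exact: QM.
Qed.

(** * Taylor expansions and congruences modulo one element *)

Section Taylor.
Variable S : comNzRingType.

Lemma taylor1 (p : {poly S}) (a e : S) : exists c, p.[a + e] = p.[a] + e * c.
Proof.
elim/poly_ind: p => [|p b [c hc]].
  by exists 0; rewrite !horner0 mulr0 addr0.
exists (p.[a] + c * a + e * c); rewrite !hornerE hc; ring.
Qed.

Lemma taylor2 (p : {poly S}) (a e : S) :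
  exists c, p.[a + e] = p.[a] + e * p^`().[a] + e ^+ 2 * c.
Proof.
elim/poly_ind: p => [|p b [c hc]].
  by exists 0; rewrite deriv0 !horner0 !mulr0 !addr0.
exists (p^`().[a] + c * a + e * c).
rewrite derivD derivM derivC derivX !hornerE hc; ring.
Qed.

Definition congr_mod (d a b : S) := exists c, a = b + d * c.

Lemma congr_modD d a b a' b' :
  congr_mod d a b -> congr_mod d a' b' -> congr_mod d (a + a') (b + b').
Proof. by case=> c -> [c' ->]; exists (c + c'); ring. Qed.

Lemma congr_modM d a b a' b' :
  congr_mod d a b -> congr_mod d a' b' -> congr_mod d (a * a') (b * b').
Proof. by case=> c -> [c' ->]; exists (c * b' + c' * b + d * c * c'); ring. Qed.

Lemma congr_mod_refl d a : congr_mod d a a.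
Proof. by exists 0; ring. Qed.

End Taylor.

Section Evaluation.
Variables (k : comNzRingType) (m : nat).
Local Notation CZ := {poly {mpoly k[m]}}.

(** The coefficient map [f] is kept general because the same polynomial is evaluated in $A$, in
    $A[U]$, in $C[Z]$ itself and in a fraction field. *)
Definition ev (S : comNzRingType) (f : k -> S) (x : 'I_m -> S) (z : S) (p : CZ)
  : S := (map_poly (mmap f x) p).[z].

Section Morphism.
Variables (S : comNzRingType) (f : {rmorphism k -> S}) (x : 'I_m -> S) (z : S).

Fact ev_zmod_morphism : zmod_morphism (ev f x z).
Proof. by move=> p q; rewrite /ev rmorphB hornerD hornerN. Qed.

Fact ev_monoid_morphism : monoid_morphism (ev f x z).
Proof. by split=> [|p q]; rewrite /ev ?rmorph1 ?hornerC // rmorphM hornerM. Qed.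

HB.instance Definition _ :=
  GRing.isZmodMorphism.Build CZ S (ev f x z) ev_zmod_morphism.
HB.instance Definition _ :=
  GRing.isMonoidMorphism.Build CZ S (ev f x z) ev_monoid_morphism.

Lemma evC p : ev f x z p%:P = mmap f x p.
Proof. by rewrite /ev map_polyC hornerC. Qed.

Lemma evCC c : ev f x z (c%:MP)%:P = f c.
Proof. by rewrite evC mmapC. Qed.

Lemma evX i : ev f x z ('X_i)%:P = x i.
Proof. by rewrite evC mmapX mmap1U. Qed.

Lemma evZ : ev f x z 'X = z.
Proof. by rewrite /ev map_polyX hornerX. Qed.

End Morphism.

Lemma CZ_ind (Q : CZ -> Prop) :
  (forall c, Q (c%:MP)%:P) -> (forall p q, Q p -> Q q -> Q (p + q)) ->
  (forall p q, Q p -> Q q -> Q (p * q)) -> (forall i, Q ('X_i)%:P) -> Q 'X ->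
  forall p, Q p.
Proof.
move=> QC QD QM QX QZ; apply: poly_gen_ind => // p.
elim/mpoly_gen_ind: p => // p q Qp Qq; first by rewrite polyCD; exact: QD.
by rewrite polyCM; exact: QM.
Qed.

(** Naturality of evaluation: this is how the effect of any morphism on $p(X,Z)$ is read off from
    its effect on the coordinates. *)
Lemma rmorph_ev (S S' : comNzRingType) (f : {rmorphism k -> S})
    (h : {rmorphism S -> S'}) (f' : {rmorphism k -> S'}) x z x' z' p :
  (forall c, h (f c) = f' c) -> (forall i, h (x i) = x' i) -> h z = z' ->
  h (ev f x z p) = ev f' x' z' p.
Proof.
move=> hf hx hz; elim/CZ_ind: p => [c|p q|p q|i|].
- by rewrite !evCC.
- by rewrite !rmorphD /= => -> ->.
- by rewrite !rmorphM /= => -> ->.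
- by rewrite !evX.
- by rewrite !evZ.
Qed.

Lemma eq_ev (S : comNzRingType) (f : {rmorphism k -> S}) x x' z p :
  (forall i, x i = x' i) -> ev f x z p = ev f x' z p.
Proof. by move=> e; exact: (@rmorph_ev _ _ f idfun f). Qed.

(** Ring operations respect congruence modulo [d]. The cofactor obtained here supplies the quotients
    needed to define images of generators without dividing. *)
Lemma ev_congr (S : comNzRingType) (f : {rmorphism k -> S}) d x z x' z' p :
  (forall i, congr_mod d (x i) (x' i)) -> congr_mod d z z' ->
  congr_mod d (ev f x z p) (ev f x' z' p).
Proof.
move=> hx hz; elim/CZ_ind: p => [c|p q|p q|i|].
- by rewrite !evCC; exact: congr_mod_refl.
- by rewrite !rmorphD; exact: congr_modD.
- by rewrite !rmorphM; exact: congr_modM.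
- by rewrite !evX.
- by rewrite !evZ.
Qed.

Lemma ev_id p : ev (polyC \o @mpolyC m k) (fun i => ('X_i)%:P) 'X p = p.
Proof.
elim/CZ_ind: p => [c|p q|p q|i|].
- by rewrite evCC.
- by rewrite !rmorphD /= => -> ->.
- by rewrite !rmorphM /= => -> ->.
- by rewrite evX.
- by rewrite evZ.
Qed.

Definition upd (S : Type) (x : 'I_m -> S) (i : 'I_m) (a : S) (j : 'I_m) :=
  if j == i then a else x j.

Lemma upd_eq (S : Type) (x : 'I_m -> S) i a : upd x i a i = a.
Proof. by rewrite /upd eqxx. Qed.

Lemma upd_neq (S : Type) (x : 'I_m -> S) i a j : j != i -> upd x i a j = x j.
Proof. by rewrite /upd => /negPf ->. Qed.

(* The value of p at X_i = 0. *)
Definition restr0 (i : 'I_m) (p : CZ) : CZ :=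
  ev (polyC \o @mpolyC m k) (upd (fun j => ('X_j)%:P) i 0) 'X p.

Lemma ev_restr0 (S : comNzRingType) (f : {rmorphism k -> S}) i x z p :
  ev f x z (restr0 i p) = ev f (upd x i 0) z p.
Proof.
apply: (@rmorph_ev _ _ _ (ev f x z) f) => [c|j|]; first by rewrite /= evCC.
  by rewrite /upd; case: (j == i); [exact: (rmorph0 (ev f x z))|exact: evX].
exact: evZ.
Qed.

(** The generic point and its modification at $X_i=0$ agree modulo $X_i$, so the values of [p] there
    do as well. *)
Lemma restr0_congr i p : exists q, p = restr0 i p + ('X_i)%:P * q.
Proof.
suff : congr_mod ('X_i)%:P (ev (polyC \o @mpolyC m k) (fun j => ('X_j)%:P) 'X p)
    (restr0 i p) by rewrite ev_id.
apply: ev_congr => [j|]; last exact: congr_mod_refl.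
rewrite /upd; case: eqP => [->|_]; last exact: congr_mod_refl.
by exists 1; rewrite add0r mulr1.
Qed.

End Evaluation.

(** * Exponential maps *)

Section IntegralRing.
Variables (A : comNzRingType) (L : idomainType) (iota : {rmorphism A -> L}).
Hypothesis iota_inj : injective iota.

Lemma inj_mulfI (a b c : A) : a != 0 -> a * b = a * c -> b = c.
Proof.
move=> a0 /(congr1 iota); rewrite !rmorphM => /mulfI e; apply/iota_inj/e.
by rewrite -(rmorph0 iota) (inj_eq iota_inj).
Qed.

Lemma inj_mulf_neq0 (a b : A) : a != 0 -> b != 0 -> a * b != 0.
Proof.
move=> a0; apply: contraNneq => ab0.
by rewrite (@inj_mulfI a b 0) ?ab0 ?mulr0.
Qed.

Lemma inj_expf_neq0 (a : A) n : a != 0 -> a ^+ n != 0.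
Proof.
move=> a0; elim: n => [|n IHn]; first by rewrite expr0 oner_eq0.
by rewrite exprS; exact: inj_mulf_neq0.
Qed.

Lemma inj_prodf_neq0 (I : finType) (P : pred I) (F : I -> A) :
  (forall i, P i -> F i != 0) -> \prod_(i | P i) F i != 0.
Proof.
move=> F0; apply: (big_ind (fun a => a != 0)) => //; first exact: oner_neq0.
exact: inj_mulf_neq0.
Qed.

Lemma map_poly_rmorph_inj : injective (map_poly iota).
Proof. exact: (map_inj_poly iota_inj (rmorph0 iota)). Qed.

(** A nonconstant polynomial over a domain is transcendental over the coefficients; the statement
    over [L] is pulled back along [iota]. *)
Lemma comp_poly_inj_eq0 (q g : {poly A}) :
  (1 < size g)%N -> q \Po g = 0 -> q = 0.
Proof.
move=> sg /(congr1 (map_poly iota)).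
rewrite rmorph0 map_comp_poly => /eqP; rewrite comp_poly_eq0.
  by rewrite -(rmorph0 (map_poly iota)) => /eqP/map_poly_rmorph_inj.
by rewrite (size_map_inj_poly iota_inj (rmorph0 iota)).
Qed.

End IntegralRing.

Section ExpAt.
Variables (k : fieldType) (A : comAlgType k) (L : idomainType).
Variables (iota : {rmorphism A -> L}) (iota_inj : injective iota).
Variable phi : alg_to_poly A.

(** The axioms of an exponential map at a single element. They are stable under sums and products,
    so it is enough to check them on generators. *)
Definition expat (b : A) : Prop :=
  (phi b).[0] = b /\ map_poly phi (phi b) = poly_XaY (phi b).

Lemma poly_XaYD (p q : {poly A}) : poly_XaY (p + q) = poly_XaY p + poly_XaY q.
Proof. by rewrite /poly_XaY rmorphD /= comp_polyD. Qed.

Lemma poly_XaYM (p q : {poly A}) : poly_XaY (p * q) = poly_XaY p * poly_XaY q.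
Proof. by rewrite /poly_XaY rmorphM /= comp_polyM. Qed.

Lemma poly_XaY_polyC (a : A) : poly_XaY a%:P = a%:P%:P.
Proof. by rewrite /poly_XaY map_polyC /= comp_polyC. Qed.

Lemma poly_XaY_X : poly_XaY 'X = 'X + 'X%:P :> {poly {poly A}}.
Proof. by rewrite /poly_XaY map_polyX comp_polyX. Qed.

Lemma expatD b c : expat b -> expat c -> expat (b + c).
Proof.
move=> [b0 bU] [c0 cU]; split; first by rewrite rmorphD hornerD b0 c0.
by rewrite !rmorphD /= bU cU -poly_XaYD.
Qed.

Lemma expatM b c : expat b -> expat c -> expat (b * c).
Proof.
move=> [b0 bU] [c0 cU]; split; first by rewrite rmorphM hornerM b0 c0.
by rewrite !rmorphM /= bU cU -poly_XaYM.
Qed.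

Lemma expat_const b : phi b = b%:P -> expat b.
Proof.
move=> e; split; rewrite e ?hornerC //.
by rewrite map_polyC /= e poly_XaY_polyC.
Qed.

Lemma phi_alg c : phi c%:A = c%:A%:P.
Proof. by rewrite linearZ /= rmorph1 -mul_polyC mulr1. Qed.

(** As [d] is fixed, applying $\phi_V$ to $b+dU$ gives $b+dV+dU=b+d(U+V)$. *)
Lemma expat_shift b d : phi b = b%:P + d%:P * 'X -> phi d = d%:P -> expat b.
Proof.
move=> eb ed; split; first by rewrite eb !hornerE.
rewrite eb rmorphD rmorphM /= map_polyX !map_polyC /= eb ed.
rewrite poly_XaYD poly_XaYM !poly_XaY_polyC poly_XaY_X polyCD polyCM.
ring.
Qed.

Lemma expat1 : expat 1.
Proof. by apply: expat_const; rewrite rmorph1. Qed.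

Lemma expatX b n : expat b -> expat (b ^+ n).
Proof.
move=> eb; elim: n => [|n IHn]; last by rewrite exprS; exact: expatM.
exact: expat1.
Qed.

Lemma expat_prod (I : finType) (P : pred I) (F : I -> A) :
  (forall i, P i -> expat (F i)) -> expat (\prod_(i | P i) F i).
Proof.
move=> F0; apply: (big_ind expat expat1 _ F0); exact: expatM.
Qed.

Lemma expat_ev m (x : 'I_m -> A) z (p : {poly {mpoly k[m]}}) :
  (forall i, expat (x i)) -> expat z -> expat (ev (GRing.in_alg A) x z p).
Proof.
move=> ex ez; elim/CZ_ind: p => [c|p q|p q|i|].
- by rewrite evCC; apply: expat_const; rewrite phi_alg.
- by rewrite rmorphD; exact: expatD.
- by rewrite rmorphM; exact: expatM.
- by rewrite evX.
- by rewrite evZ.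
Qed.

(* Both sides of each axiom are multiplicative in b, with values in a domain;
   hence the axioms need only be checked up to a nonzero factor. *)
Lemma expat_div b c : b != 0 -> expat b -> expat (b * c) -> expat c.
Proof.
move=> bn0 [b0 bU] []; rewrite rmorphM hornerM b0.
move/(inj_mulfI iota_inj bn0) => c0.
rewrite rmorphM /= poly_XaYM bU => e; split=> //.
apply: (inj_mulfI (map_poly_rmorph_inj (map_poly_rmorph_inj iota_inj)) _ e).
(* The cancelled factor is nonzero: setting $U=0$ in $\phi_{U+V}(b)$ gives back $\phi_V(b)$, whose
   value at 0 is $b$. *)
apply: contraNneq bn0 => eb; move: (horner_poly_XaY (phi b) 0).
rewrite eb horner0 add0r comp_polyXr => e0.
by rewrite -b0 -e0 horner0.
Qed.

End ExpAt.

Section RmorphAlgToPoly.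
Variables (k : fieldType) (A : comAlgType k) (h : {rmorphism A -> {poly A}}).
Hypothesis hc : forall c, h c%:A = c%:A%:P.

(* The dummy argument lets the instances below depend on hc. *)
Let f (_ : forall c : k, h c%:A = c%:A%:P) : A -> {poly A} := h.

Fact rmorph_scalable : scalable_for (GRing.in_alg A \; *:%R) (f hc).
Proof. by move=> c a; rewrite /f -mulr_algl rmorphM hc /= mul_polyC. Qed.

HB.instance Definition _ := GRing.RMorphism.copy (f hc) h.
HB.instance Definition _ :=
  GRing.isScalable.Build k A {poly A} (GRing.in_alg A \; *:%R) (f hc)
    rmorph_scalable.

Definition rmorph_alg_to_poly : alg_to_poly A := f hc.

End RmorphAlgToPoly.

(** Generation as a $k$-algebra, encoded as the induction principle in which it is applied. *)
Definition generated_by (k : fieldType) (m : nat) (A : comAlgType k)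
    (x : 'I_m -> A) (y z t : A) : Prop :=
  forall Q : A -> Prop, (forall c, Q c%:A) ->
    (forall a b, Q a -> Q b -> Q (a + b)) ->
    (forall a b, Q a -> Q b -> Q (a * b)) ->
    (forall i, Q (x i)) -> Q y -> Q z -> Q t -> forall a, Q a.

(* A = k[X, Y, Z, T] / (X^r Y - g(X, Z) - l(X, Z) T), given by generators and
   universal property, so that a change of generators amounts to an
   isomorphism; in the paper's notation g = a0 + H~ and l = a1. *)
Record hypersurface (k : fieldType) (m : nat) (r : 'I_m -> nat)
    (g l : {poly {mpoly k[m]}}) (A : comAlgType k) (x : 'I_m -> A) (y z t : A)
    : Prop := Hypersurface {
  hs_eq : (\prod_i x i ^+ r i) * y =
    ev (GRing.in_alg A) x z g + ev (GRing.in_alg A) x z l * t;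
  hs_ind : generated_by x y z t;
  hs_lift : forall (S : comNzRingType) (f : {rmorphism k -> S}) x' y' z' t',
    (\prod_i x' i ^+ r i) * y' = ev f x' z' g + ev f x' z' l * t' ->
    exists h : {rmorphism A -> S},
      [/\ forall c, h c%:A = f c, forall i, h (x i) = x' i,
          h y = y', h z = z' & h t = t'];
  hs_free : forall p, ev (GRing.in_alg A) x z p = 0 -> p = 0;
  hs_domain : exists (L : idomainType) (iota : {rmorphism A -> L}),
    injective iota }.

Section Lift.
Variables (k : fieldType) (m : nat) (r : 'I_m -> nat).
Variables (g l : {poly {mpoly k[m]}}) (A : comAlgType k).
Variables (x : 'I_m -> A) (y z t : A).
Hypothesis hA : hypersurface r g l x y z t.

Lemma hs_ext (S : nzRingType) (h h' : {rmorphism A -> S}) :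
  (forall c, h c%:A = h' c%:A) -> (forall i, h (x i) = h' (x i)) ->
  h y = h' y -> h z = h' z -> h t = h' t -> h =1 h'.
Proof.
move=> hc hx hy hz ht; apply: (hs_ind hA) => // a b ea eb.
  by rewrite !rmorphD ea eb.
by rewrite !rmorphM ea eb.
Qed.

Lemma hs_lift_poly x' y' z' t' :
  let f := polyC \o GRing.in_alg A in
  (\prod_i x' i ^+ r i) * y' = ev f x' z' g + ev f x' z' l * t' ->
  exists phi : alg_to_poly A,
    [/\ forall i, phi (x i) = x' i, phi y = y', phi z = z' & phi t = t'].
Proof.
move=> f e.
have [h [hc hx hy hz ht]] := hs_lift hA (f := polyC \o GRing.in_alg A) e.
by exists (rmorph_alg_to_poly hc); split.
Qed.

Lemma hs_EXP (phi : alg_to_poly A) :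
  (forall i, expat phi (x i)) -> expat phi z -> expat phi t -> expat phi y ->
  EXP A phi.
Proof.
move=> ex ez et ey; have e : forall b, expat phi b.
  apply: (hs_ind hA _ (@expatD _ _ phi) (@expatM _ _ phi) ex ey ez et) => c.
  exact/expat_const/phi_alg.
by split=> b; have [] := e b.
Qed.

End Lift.

(** * Exponential maps and invariants of hypersurfaces *)

Lemma invariants_neqT (k : fieldType) (A : comAlgType k) (phi : alg_to_poly A)
    (b d : A) :
  phi b = b%:P + d%:P * 'X -> d != 0 -> invariants phi != setT.
Proof.
move=> e dn0; apply/eqP => iT; have : invariants phi b by rewrite iT.
rewrite /invariants /= e -[X in _ = X]addr0 => /addrI.
move/(congr1 (fun p : {poly A} => p`_1)); rewrite coef0 coefCM coefX mulr1.
by move=> d0; rewrite d0 eqxx in dn0.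
Qed.

(** * Clearing denominators by powers of $X^r$ *)

Section Denominators.
Variables (k : fieldType) (m : nat) (r : 'I_m -> nat).

Definition xmon : {poly {mpoly k[m]}} := \prod_i ('X_i)%:P ^+ r i.

Lemma ev_xmon (S : comNzRingType) (f : {rmorphism k -> S}) x' z' :
  ev f x' z' xmon = \prod_i x' i ^+ r i.
Proof.
by rewrite rmorph_prod; apply: eq_bigr => i _; rewrite rmorphXn /= evX.
Qed.

Variables (g l : {poly {mpoly k[m]}}) (A : comAlgType k).
Variables (x : 'I_m -> A) (y z t : A).
Local Notation inA := (GRing.in_alg A).
Local Notation D := (\prod_i x i ^+ r i).

(** The equation trades $X^rY$ for $g+lT$, and sums and products are brought to a common power. Only
    the equation and generation are assumed, because the lemma also serves to prove that the
    quotient is a domain. *)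
Lemma hs_denominator : D * y = ev inA x z g + ev inA x z l * t ->
  generated_by x y z t -> forall a,
  exists (N : nat) (p : {poly {poly {mpoly k[m]}}}),
  D ^+ N * a = (map_poly (ev inA x z) p).[t].
Proof.
move=> hs_eq hs_ind a.
pose E (p : {poly {poly {mpoly k[m]}}}) := (map_poly (ev inA x z) p).[t].
have ED p q : E (p + q) = E p + E q by rewrite /E rmorphD hornerD.
have EM p q : E (p * q) = E p * E q by rewrite /E rmorphM hornerM.
have EC p : E p%:P = ev inA x z p by rewrite /E map_polyC hornerC.
have Emon N : E (xmon ^+ N)%:P = D ^+ N.
  by rewrite EC rmorphXn /= ev_xmon.
move: a; apply: hs_ind.
- move=> c; exists 0%N, (c%:MP)%:P%:P; rewrite -/(E _) EC evCC expr0.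
  by rewrite mul1r.
- move=> a b [N [p ep]] [M [q eq]].
  exists (N + M)%N, ((xmon ^+ M)%:P * p + (xmon ^+ N)%:P * q).
  rewrite -/(E _) ED !EM !Emon; move: ep eq; rewrite -!/(E _) => <- <-.
  by rewrite exprD; ring.
- move=> a b [N [p ep]] [M [q eq]].
  exists (N + M)%N, (p * q).
  rewrite -/(E _) !EM; move: ep eq; rewrite -!/(E _) => <- <-.
  by rewrite exprD; ring.
- move=> i; exists 0%N, ('X_i)%:P%:P; rewrite -/(E _) EC evX expr0.
  by rewrite mul1r.
- exists 1%N, (g%:P + l%:P * 'X).
  by rewrite -/(E _) ED EM !EC /E map_polyX hornerX expr1 hs_eq.
- by exists 0%N, 'X%:P; rewrite -/(E _) EC evZ expr0 mul1r.
- by exists 0%N, 'X; rewrite map_polyX hornerX expr0 mul1r.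
Qed.

End Denominators.

(** * Exponential maps moving $Z$, $T$ or $X_i$, and the Derksen invariant *)

Section HypersurfaceExp.
Variables (k : fieldType) (m : nat) (r : 'I_m -> nat).
Variables (g l : {poly {mpoly k[m]}}) (A : comAlgType k).
Variables (x : 'I_m -> A) (y z t : A).
Hypothesis hA : hypersurface r g l x y z t.

Local Notation inA := (GRing.in_alg A).
Local Notation inAU := (polyC \o GRing.in_alg A).
Local Notation D := (\prod_i x i ^+ r i).

Lemma ev_polyC p : ev inAU (polyC \o x) z%:P p = (ev inA x z p)%:P.
Proof. by apply/esym/(@rmorph_ev _ _ _ _ inA polyC inAU). Qed.

Lemma hs_ev_neq0 p : p != 0 -> ev inA x z p != 0.
Proof. by apply: contraNneq => /(hs_free hA) ->. Qed.

Lemma hs_x_neq0 i : x i != 0.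
Proof.
rewrite -(evX inA x z); apply: hs_ev_neq0.
by rewrite polyC_eq0 -msize_poly_eq0 msizeX.
Qed.

Lemma hs_D_neq0 : D != 0.
Proof.
have [L [iota iota_inj]] := hs_domain hA.
apply: (inj_prodf_neq0 iota_inj) => i _.
exact/(inj_expf_neq0 iota_inj)/hs_x_neq0.
Qed.

Lemma phi_prod_const (phi : alg_to_poly A) :
  (forall i, phi (x i) = (x i)%:P) -> phi D = D%:P.
Proof.
move=> ex; rewrite !rmorph_prod; apply: eq_bigr => i _.
by rewrite !rmorphXn /= ex.
Qed.

Lemma phi_ev_const (phi : alg_to_poly A) p :
  (forall i, phi (x i) = (x i)%:P) -> phi z = z%:P ->
  phi (ev inA x z p) = (ev inA x z p)%:P.
Proof.
move=> ex ez; rewrite -ev_polyC.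
by apply: (@rmorph_ev _ _ _ _ inA phi inAU) => // c; exact: phi_alg.
Qed.

(** Shifting $Z$ by $X^rU$ changes $g$ and $l$ by multiples $X^rc_1$ and $X^rc_2$, so $Y\mapsto
    Y+c_1+c_2T$ preserves the equation. The axioms at [y] follow from those at $X^ry=g+lt$ by
    cancelling $X^r$. *)
Lemma exp_z : exists phi : alg_to_poly A,
  [/\ EXP A phi, forall i, phi (x i) = (x i)%:P,
      phi z = z%:P + D%:P * 'X & phi t = t%:P].
Proof.
have [L [iota iota_inj]] := hs_domain hA.
have ecg p : congr_mod D%:P (ev inAU (polyC \o x) (z%:P + D%:P * 'X) p)
    (ev inA x z p)%:P.
  rewrite -ev_polyC; apply: ev_congr => [i|]; first exact: congr_mod_refl.
  by exists 'X.
have [c1 e1] := ecg g; have [c2 e2] := ecg l.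
have [|phi [ex ey ez et]] := hs_lift_poly hA (x' := polyC \o x)
    (y' := y%:P + c1 + c2 * t%:P) (z' := z%:P + D%:P * 'X) (t' := t%:P).
  rewrite e1 e2 -[X in X * _ = _](_ : D%:P = _).
    by rewrite !mulrDr -polyCM (hs_eq hA) polyCD polyCM; ring.
  by rewrite rmorph_prod; apply: eq_bigr => i _; rewrite rmorphXn.
exists phi; split=> //.
have hx i : expat phi (x i) by apply: expat_const; rewrite ex.
have hz : expat phi z by apply: (expat_shift ez); exact: phi_prod_const.
have ht : expat phi t by exact: expat_const.
apply: (hs_EXP hA hx hz ht); apply: (expat_div iota_inj hs_D_neq0).
  by apply: expat_prod => i _; exact: (expatX _ (hx i)).
rewrite (hs_eq hA); apply: expatD; first exact: (expat_ev _ hx hz).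
exact: (expatM (expat_ev _ hx hz) ht).
Qed.

Lemma exp_t : exists phi : alg_to_poly A,
  [/\ EXP A phi, forall i, phi (x i) = (x i)%:P, phi z = z%:P,
      phi t = t%:P + D%:P * 'X & phi y = y%:P + (ev inA x z l)%:P * 'X].
Proof.
have [|phi [ex ey ez et]] := hs_lift_poly hA (x' := polyC \o x)
    (y' := y%:P + (ev inA x z l)%:P * 'X) (z' := z%:P)
    (t' := t%:P + D%:P * 'X).
  rewrite !ev_polyC -[X in X * _ = _](_ : D%:P = _).
    by rewrite mulrDr -polyCM (hs_eq hA) polyCD polyCM; ring.
  by rewrite rmorph_prod; apply: eq_bigr => i _; rewrite rmorphXn.
exists phi; split=> //.
have hx i : expat phi (x i) by apply: expat_const; rewrite ex.
have hz : expat phi z by exact: expat_const.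
apply: (hs_EXP hA hx hz).
  by apply: (expat_shift et); exact: phi_prod_const.
by apply: (expat_shift ey); exact: phi_ev_const.
Qed.

(** The second hypothesis says that [l] is free of the $X_j$. Shifting $X_i$ by $lU$ changes $g$ and
    $X^r$ by multiples $lc_1$ and $lc_2$ of [l], and $T\mapsto T+c_2Y-c_1$ absorbs both. The axioms
    at [t] follow from those at $lt=X^ry-g$. *)
Lemma exp_x i : l != 0 ->
  (forall (S : comNzRingType) (f : {rmorphism k -> S}) x' x'' z',
     ev f x' z' l = ev f x'' z' l) ->
  exists phi : alg_to_poly A,
  [/\ EXP A phi, forall j, j != i -> phi (x j) = (x j)%:P,
      phi (x i) = (x i)%:P + (ev inA x z l)%:P * 'X, phi z = z%:P &
      phi y = y%:P].
Proof.
move=> l0 lx; have [L [iota iota_inj]] := hs_domain hA.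
set lam := ev inA x z l; pose x' := upd (polyC \o x) i ((x i)%:P + lam%:P * 'X).
have ecg p : congr_mod lam%:P (ev inAU x' z%:P p) (ev inA x z p)%:P.
  rewrite -ev_polyC; apply: ev_congr => [j|]; last exact: congr_mod_refl.
  rewrite /x' /upd; case: eqP => [->|_]; last exact: congr_mod_refl.
  by exists 'X.
have [c1 e1] := ecg g; have [c2] := ecg (xmon k r); rewrite !ev_xmon => e2.
have [|phi [ex ey ez et]] := hs_lift_poly hA (x' := x')
    (y' := y%:P) (z' := z%:P) (t' := t%:P + c2 * y%:P - c1).
  rewrite e1 e2 (lx _ _ x' (polyC \o x)) ev_polyC -/lam mulrDl -polyCM.
  by rewrite (hs_eq hA) -/lam polyCD polyCM; ring.
have exj j : j != i -> phi (x j) = (x j)%:P.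
  by move=> ji; rewrite ex /x' upd_neq.
have exi : phi (x i) = (x i)%:P + lam%:P * 'X by rewrite ex /x' upd_eq.
exists phi; split=> //.
have elam : phi lam = lam%:P.
  rewrite /lam (@rmorph_ev _ _ _ _ inA phi inAU x z (phi \o x) z%:P) //.
    by rewrite (lx _ _ (phi \o x) (polyC \o x)) ev_polyC.
  exact: phi_alg.
have hx j : expat phi (x j).
  have [->|ji] := eqVneq j i; first exact: (expat_shift exi).
  by apply: expat_const; exact: exj.
have hz : expat phi z by exact: expat_const.
have hy : expat phi y by exact: expat_const.
apply: (hs_EXP hA hx hz _ hy).
apply: (expat_div iota_inj (hs_ev_neq0 l0) (expat_ev _ hx hz)).
have -> : ev inA x z l * t = D * y + (- 1)%:A * ev inA x z g.
  by rewrite (hs_eq hA) mulr_algl scaleN1r; ring.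
apply: expatD; apply: expatM; [|exact: hy| |exact: (expat_ev _ hx hz)].
  by apply: expat_prod => j _; exact: (expatX _ (hx j)).
by apply: expat_const; rewrite phi_alg.
Qed.

(** The shift of $Z$ fixes all $X_i$ and $T$, the shift of $T$ fixes $Z$, and both are nontrivial;
    only $Y$ has to come from the hypothesis. *)
Lemma hs_DK :
  (exists phi, [/\ EXP A phi, invariants phi y & invariants phi != setT]) ->
  DK A = setT.
Proof.
have D0 := hs_D_neq0.
have [phi1 [E1 x1 z1 t1]] := exp_z; have [phi2 [E2 x2 z2 t2 y2]] := exp_t.
move=> [phi3 [E3 y3 T3]]; apply/seteqP; split=> // a _ S [/= Salg Ssub].
have memS (phi : alg_to_poly A) b : EXP A phi -> invariants phi != setT ->
    invariants phi b -> S b.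
  move=> E T e; apply: Ssub; exists phi => //; split=> //.
  by rewrite properEneq; split.
have S1 : S 1 by case: Salg => /set_mem.
have SZ : forall c b b', S b -> S b' -> S (c *: b + b').
  by case: Salg => _ h _ c b b' /mem_set Sb /mem_set /(h c _ _ Sb) /set_mem.
have SM : forall b b', S b -> S b' -> S (b * b').
  by case: Salg => _ _ h b b' /mem_set Sb /mem_set /(h _ _ Sb) /set_mem.
have S0 : S 0 by have := SZ (-1) 1 1 S1 S1; rewrite scaleN1r addNr.
move: a; apply: (hs_ind hA) => [c|b b' Sb Sb'|||||].
- by have := SZ c 1 0 S1 S0; rewrite addr0.
- by have := SZ 1 b b' Sb Sb'; rewrite scale1r.
- exact: SM.
- move=> i; apply: (memS phi1) => //; exact: (invariants_neqT z1).
- exact: (memS phi3).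
- by apply: (memS phi2) => //; exact: (invariants_neqT t2).
- by apply: (memS phi1) => //; exact: (invariants_neqT z1).
Qed.

End HypersurfaceExp.

(** * The Makar-Limanov invariant *)

Section Makar.
Variables (k : fieldType) (m : nat) (r : 'I_m -> nat).
Variables (g l : {poly {mpoly k[m]}}) (A : comAlgType k).
Variables (x : 'I_m -> A) (y z t : A).
Hypothesis hA : hypersurface r g l x y z t.

Local Notation inA := (GRing.in_alg A).
Local Notation inAU := (polyC \o GRing.in_alg A).
Local Notation D := (\prod_i x i ^+ r i).

(* phi b is transcendental over A, so q(phi b) = v forces q = v. *)
Lemma inv_horner (phi : alg_to_poly A) (q : {poly A}) b c v :
  map_poly phi q = map_poly polyC q -> (1 < size (phi b))%N ->
  phi v = v%:P -> q.[b] = v -> q.[c] = v.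
Proof.
have [L [iota iota_inj]] := hs_domain hA.
move=> eq sb ev qb; have : (q - v%:P) \Po phi b = 0.
  by rewrite comp_polyB comp_polyC -ev -qb -horner_map /= eq subrr.
move/(comp_poly_inj_eq0 iota_inj sb)/eqP; rewrite subr_eq0 => /eqP ->.
by rewrite hornerC.
Qed.

Lemma size_shift (b d : A) : d != 0 -> (1 < size (b%:P + d%:P * 'X)%R)%N.
Proof.
move=> d0; rewrite ltnNge; apply: contra d0 => /leq_sizeP /(_ 1%N (leqnn _)).
by rewrite coefD coefC coefCM coefX mulr1 add0r => ->.
Qed.

Lemma phi_D_const (phi : alg_to_poly A) N b :
  (forall i, phi (x i) = (x i)%:P) -> phi b = b%:P ->
  phi (D ^+ N * b) = (D ^+ N * b)%:P.
Proof.
move=> ex eb; rewrite rmorphM rmorphXn /=.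
by rewrite eb (phi_prod_const r ex) rmorphM rmorphXn.
Qed.

Lemma hs_ML :
  (forall i, exists phi : alg_to_poly A,
     [/\ EXP A phi, forall j, j != i -> phi (x j) = (x j)%:P &
         (1 < size (phi (x i)))%N]) ->
  ML A = range (GRing.in_alg A).
Proof.
move=> hmove; apply/seteqP; split=> [b bML|_ [c _ <-] phi _]; last first.
  exact: phi_alg.
have binv phi : EXP A phi -> phi b = b%:P by move=> /bML.
have D0 := hs_D_neq0 hA.
have [N [p ep]] := hs_denominator (hs_eq hA) (hs_ind hA) b.
have {p ep}[p ep] : exists p, D ^+ N * b = ev inA x z p.
  have [phi [Ephi ex ez et ey]] := exp_t hA.
  exists p`_0; rewrite -[RHS](coef_map (ev inA x z) p 0) -horner_coef0.
  apply/esym/(@inv_horner phi _ t) => //.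
  - rewrite -!map_poly_comp; apply: eq_map_poly => q /=.
    exact: phi_ev_const.
  - by rewrite et; exact: size_shift.
  - by apply: phi_D_const => //; exact: binv.
(* Specialise $Z$ to 0 in the same way, by the shift of $Z$. *)
have {p ep}[p ep] : exists p, D ^+ N * b = ev inA x 0 p%:P.
  have [phi [Ephi ex ez et]] := exp_z hA.
  exists p`_0; rewrite evC -[RHS](coef_map (mmap inA x) p 0) -horner_coef0.
  apply/esym/(@inv_horner phi _ z) => //.
  - rewrite -!map_poly_comp; apply: eq_map_poly => q /=.
    rewrite -(evC inA x 0).
    rewrite (@rmorph_ev _ _ _ _ inA phi inAU x 0 (polyC \o x) 0) ?rmorph0 //.
      by apply/esym/(@rmorph_ev _ _ _ _ inA polyC inAU).
    exact: phi_alg.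
  - by rewrite ez; exact: size_shift.
  - by apply: phi_D_const => //; exact: binv.
(* The $X_i$ are specialised to 1 one at a time; [s] lists those already done. *)
pose xs (s : seq 'I_m) j := if j \in s then 1 else x j.
have key (s : seq 'I_m) : uniq s ->
    ev inA (xs s) 0 (xmon k r ^+ N) * b = ev inA (xs s) 0 p%:P.
  elim: s => [_|i s IHs /=/andP[si /IHs{}IHs]].
    by rewrite rmorphXn /= ev_xmon.
  have [phi [Ephi ex si1]] := hmove i.
  pose Y := upd (polyC \o xs s) i 'X.
  (* Now both sides depend on $X_i$, so their difference is taken as a polynomial in $X_i$. It
     vanishes at [x i], and [inv_horner] with value 0 makes it vanish at 1. *)
  pose q := ev inAU Y 0 (xmon k r ^+ N) * b%:P - ev inAU Y 0 p%:P.
  have qE c : q.[c] = ev inA (upd (xs s) i c) 0 (xmon k r ^+ N) * b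
      - ev inA (upd (xs s) i c) 0 p%:P.
    have hE w : (ev inAU Y 0 w).[c] = ev inA (upd (xs s) i c) 0 w.
      rewrite -[LHS]/(horner_eval c _); apply: rmorph_ev => [a|j|].
      - exact: hornerC.
      - by rewrite /Y /upd; case: (j == i); [exact: hornerX|exact: hornerC].
      - exact: rmorph0.
    by rewrite /q hornerD hornerN hornerM hornerC !hE.
  have q0 : q.[1] = 0.
    apply: (@inv_horner phi _ (x i)) => //; last first.
    - have e w : ev inA (upd (xs s) i (x i)) 0 w = ev inA (xs s) 0 w.
        apply: eq_ev => j; rewrite /upd /xs; case: eqP => // ->.
        by rewrite (negPf si).
      by rewrite qE !e IHs subrr.
    - by rewrite rmorph0.
    (* The coefficients involve only scalars, 1 and the $x_j$ with $j\neq i$, all fixed by [phi]. *)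
    have hE w : map_poly phi (ev inAU Y 0 w) = map_poly polyC (ev inAU Y 0 w).
      pose Y' := upd (polyC \o polyC \o xs s) i 'X.
      rewrite (@rmorph_ev _ _ _ _ _ (map_poly phi) (polyC \o inAU) Y 0 Y' 0) //.
      - apply/esym/rmorph_ev => [a|j|]; last exact: rmorph0.
          exact: map_polyC.
        rewrite /Y /Y' /upd.
        by case: (j == i); [exact: map_polyX|exact: map_polyC].
      - by move=> a; rewrite /= map_polyC /= phi_alg.
      - move=> j; rewrite /Y /Y' /upd; case: eqP => [_|/eqP ji].
          exact: map_polyX.
        apply: etrans (map_polyC _ _) _; rewrite /= /xs.
        case: (j \in s); last by rewrite ex.
        by rewrite rmorph1.
      - exact: rmorph0.
    have gen (h h' : {rmorphism {poly A} -> {poly {poly A}}}) u v w :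
        h u = h' u -> h v = h' v -> h w = h' w ->
        h (u * v - w) = h' (u * v - w).
      by move=> eu ev ew; rewrite !rmorphB !rmorphM eu ev ew.
    apply: (gen (map_poly phi) (map_poly polyC)); [exact: hE| |exact: hE].
    by apply: etrans (map_polyC _ _) _; rewrite /= binv // map_polyC.
  have e1 w : ev inA (xs (i :: s)) 0 w = ev inA (upd (xs s) i 1) 0 w.
    by apply: eq_ev => j; rewrite /xs /upd inE; case: eqP.
  by rewrite !e1; apply/eqP; rewrite -subr_eq0 -qE q0.
have := key _ (enum_uniq 'I_m).
have xs1 j : xs (enum 'I_m) j = 1 by rewrite /xs mem_enum.
rewrite rmorphXn /= ev_xmon big1 => [|j _]; last by rewrite xs1 expr1n.
rewrite expr1n mul1r => ->.
exists (ev idfun (fun=> 1) 0 p%:P) => //.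
apply: (@rmorph_ev _ _ _ _ idfun inA inA) => // [j|]; last exact: rmorph0.
by rewrite xs1 rmorph1.
Qed.

End Makar.

(** * The quotient as a hypersurface *)

Lemma rmorph_ideal_gen (R S : comNzRingType) (f : {rmorphism R -> S})
    (s : seq R) a :
  {in s, forall b, f b = 0} -> ideal_gen s a -> f a = 0.
Proof.
move=> fs [c ->]; rewrite rmorph_sum big1 // => j _.
by rewrite rmorphM (fs _ (mem_nth 0 (ltn_ord j))) mulr0.
Qed.

Lemma horner_map0 (R S : nzRingType) (f : {rmorphism R -> S}) (a : S) :
  (map_poly f 0).[a] = 0.
Proof. by rewrite rmorph0 horner0. Qed.

Lemma rmorph_horner_map (R S S' : comNzRingType) (f : {rmorphism R -> S})
    (h : {rmorphism S -> S'}) (e : {rmorphism {poly R} -> S'}) (a : S) p :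
  (forall c, h (f c) = e c%:P) -> h a = e 'X ->
  h (map_poly f p).[a] = e p.
Proof.
move=> hf ha; elim/poly_ind: p => [|p c IHp].
  by rewrite horner_map0 !rmorph0.
by rewrite !(rmorphD, rmorphM) /= map_polyX map_polyC !hornerE rmorphD rmorphM
  /= IHp hf ha.
Qed.

Lemma horner_linear (S : nzRingType) (a b c : S) :
  (a%:P + b%:P * 'X).[c] = a + b * c.
Proof. by rewrite !hornerE. Qed.

Section Quotient.
Variables (k : fieldType) (m : nat) (r : 'I_m -> nat).
Variables (a0 a1 : {poly k}) (Ht : {poly {mpoly k[m]}}).
Variable (H : {poly {poly {mpoly k[m]}}}).

Let g := map_poly (@mpolyC m k) a0 + Ht.
Let l := map_poly (@mpolyC m k) a1.

Hypothesis hH : H = g%:P + l%:P * 'X.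
Hypothesis ha : a0%:P + a1%:P * 'X != 0 :> {poly {poly k}}.
Hypothesis hHt : ideal_gen [seq ('X_i)%:P | i : 'I_m] Ht.

Local Notation P := {mpoly k[m + 3]}.
Local Notation A := (hyp_alg r H).
Local Notation vX := (@varX k m).
Local Notation vY := (@varY k m).
Local Notation vZ := (@varZ k m).
Local Notation vT := (@varT k m).

Lemma ord_m3_ind (Q : 'I_(m + 3) -> Prop) :
  (forall i, Q (lshift 3 i)) -> Q (rshift m (@Ordinal 3 0 isT)) ->
  Q (rshift m (@Ordinal 3 1 isT)) -> Q (rshift m (@Ordinal 3 2 isT)) ->
  forall i, Q i.
Proof.
move=> QX Q0 Q1 Q2 i; rewrite -(splitK i); case: (split i) => //= j.
case: j => [[|[|[|j]]] hj] //.
- by rewrite (_ : Ordinal hj = @Ordinal 3 0 isT) //; exact: val_inj.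
- by rewrite (_ : Ordinal hj = @Ordinal 3 1 isT) //; exact: val_inj.
- by rewrite (_ : Ordinal hj = @Ordinal 3 2 isT) //; exact: val_inj.
Qed.

Lemma P_ind (Q : P -> Prop) :
  (forall c, Q c%:MP) -> (forall p q, Q p -> Q q -> Q (p + q)) ->
  (forall p q, Q p -> Q q -> Q (p * q)) -> (forall i, Q (vX i)) ->
  Q vY -> Q vZ -> Q vT -> forall p, Q p.
Proof.
by move=> QC QD QM QX QY QZ QT; apply: mpoly_gen_ind => //; apply: ord_m3_ind.
Qed.

Lemma embCE p : embC p = mmap (@mpolyC _ k) vX p.
Proof.
rewrite /embC /comp_mpoly -!(evC _ _ 0); apply: eq_ev => i.
by rewrite tnth_mktuple.
Qed.

Lemma embCZE p : embCZ p = ev (@mpolyC _ k) vX vZ p.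
Proof. by rewrite /embCZ /ev (eq_map_poly embCE). Qed.

Lemma embCZTE :
  embCZT H = ev (@mpolyC _ k) vX vZ g + ev (@mpolyC _ k) vX vZ l * vT.
Proof.
rewrite /embCZT (eq_map_poly (g := ev (@mpolyC _ k) vX vZ) embCZE).
rewrite hH (rmorphD (map_poly _)) (rmorphM (map_poly _)) /=.
rewrite !map_polyC map_polyX /=.
exact: horner_linear.
Qed.

Section Values.
Variables (S : comNzRingType) (f : {rmorphism k -> S}).
Variables (x' : 'I_m -> S) (y' z' t' : S).

Definition point (i : 'I_(m + 3)) : S :=
  match split i with inl j => x' j | inr j => [:: y'; z'; t']`_j end.

Lemma pointX i : mmap f point (vX i) = x' i.
Proof.
by rewrite mmapX mmap1U /point -[lshift 3 i]/(unsplit (inl i)) unsplitK.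
Qed.

Lemma pointR j : mmap f point 'X_(rshift m j) = [:: y'; z'; t']`_j.
Proof.
by rewrite mmapX mmap1U /point -[rshift m j]/(unsplit (inr j)) unsplitK.
Qed.

Lemma mmap_point_ev p : mmap f point (ev (@mpolyC _ k) vX vZ p) = ev f x' z' p.
Proof.
apply: (@rmorph_ev _ _ _ _ (@mpolyC _ k) (mmap f point) f) => [c|i|].
- exact: mmapC.
- exact: pointX.
- exact: pointR.
Qed.

Lemma mmap_point_embCZT :
  mmap f point (embCZT H) = ev f x' z' g + ev f x' z' l * t'.
Proof.
by rewrite embCZTE rmorphD rmorphM /= !mmap_point_ev pointR.
Qed.

Lemma mmap_point_eqn :
  mmap f point (hyp_eqn r H) =
  (\prod_i x' i ^+ r i) * y' - (ev f x' z' g + ev f x' z' l * t').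
Proof.
rewrite /hyp_eqn rmorphB rmorphM /= mmap_point_embCZT pointR; congr (_ * _ - _).
by rewrite rmorph_prod; apply: eq_bigr => i _; rewrite rmorphXn /= pointX.
Qed.

End Values.

Definition hyp_pi (p : P) : A := \pi_({ideal_quot (hyp_ideal r H)})%qT p.

Fact hyp_pi_zmod : zmod_morphism hyp_pi.
Proof. by move=> p q; rewrite /hyp_pi rmorphB. Qed.

Fact hyp_pi_monoid : monoid_morphism hyp_pi.
Proof. by split=> [|p q]; rewrite /hyp_pi ?rmorph1 ?rmorphM. Qed.

HB.instance Definition _ := GRing.isZmodMorphism.Build P A hyp_pi hyp_pi_zmod.
HB.instance Definition _ :=
  GRing.isMonoidMorphism.Build P A hyp_pi hyp_pi_monoid.

Lemma hyp_piP (a : A) : exists p, a = hyp_pi p.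
Proof. by exists (repr a); rewrite /hyp_pi reprK. Qed.

Lemma hyp_pi_eq0 p : hyp_pi p = 0 <-> exists c, p = c * hyp_eqn r H.
Proof.
rewrite -(rmorph0 hyp_pi); split.
  by move=> /eqP; rewrite /hyp_pi -Quotient.idealrBE subr0 => /hyp_idealP.
move=> /hyp_idealP h; apply/eqP; rewrite /hyp_pi -Quotient.idealrBE subr0.
exact: h.
Qed.

Lemma hyp_piC c : hyp_pi c%:MP = c%:A.
Proof.
by rewrite /GRing.scale /= /quot_scale mulr1 -alg_mpolyC.
Qed.

Local Notation px := (fun i => hyp_pi (vX i)).

Lemma hyp_pi_ev p :
  hyp_pi (ev (@mpolyC _ k) vX vZ p) = ev (GRing.in_alg A) px (hyp_pi vZ) p.
Proof.
by apply: (@rmorph_ev _ _ _ _ (@mpolyC _ k) hyp_pi (GRing.in_alg A)) => // c;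
  exact: hyp_piC.
Qed.

Lemma hyp_eq : (\prod_i px i ^+ r i) * hyp_pi vY =
  ev (GRing.in_alg A) px (hyp_pi vZ) g +
  ev (GRing.in_alg A) px (hyp_pi vZ) l * hyp_pi vT.
Proof.
have /hyp_pi_eq0 : exists c, hyp_eqn r H = c * hyp_eqn r H.
  by exists 1; rewrite mul1r.
rewrite /hyp_eqn embCZTE rmorphB rmorphM rmorphD rmorphM /= !hyp_pi_ev.
move/eqP; rewrite subr_eq0 => /eqP <-; congr (_ * _).
by rewrite rmorph_prod; apply: eq_bigr => i _; rewrite rmorphXn.
Qed.

Lemma hyp_ind : generated_by px (hyp_pi vY) (hyp_pi vZ) (hyp_pi vT).
Proof.
move=> Q QC QD QM QX QY QZ QT a; have [p ->] := hyp_piP a.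
elim/P_ind: p => // [c|p q Qp Qq|p q Qp Qq].
- by rewrite hyp_piC.
- by rewrite rmorphD; exact: QD.
- by rewrite rmorphM; exact: QM.
Qed.

Lemma hyp_lift (S : comNzRingType) (f : {rmorphism k -> S}) x' y' z' t' :
  (\prod_i x' i ^+ r i) * y' = ev f x' z' g + ev f x' z' l * t' ->
  exists h : {rmorphism A -> S},
    [/\ forall c, h c%:A = f c, forall i, h (px i) = x' i,
        h (hyp_pi vY) = y', h (hyp_pi vZ) = z' & h (hyp_pi vT) = t'].
Proof.
move=> e; pose F := mmap f (point x' y' z' t').
(* Evaluate a chosen representative; the choice does not matter, since [F] kills the equation. *)
pose h (a : A) : S := F (projT1 (cid (hyp_piP a))).
have hF p : h (hyp_pi p) = F p.
  rewrite /h; case: cid => q /= /eqP; rewrite -subr_eq0 -rmorphB => /eqP.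
  move=> /hyp_pi_eq0[c] /(congr1 F); rewrite /F rmorphB rmorphM /=.
  rewrite mmap_point_eqn e subrr mulr0.
  by move/eqP; rewrite subr_eq0 => /eqP.
have hzmod : zmod_morphism h.
  move=> a b; have [p ->] := hyp_piP a; have [q ->] := hyp_piP b.
  by rewrite -rmorphB !hF /F rmorphB.
have hmon : monoid_morphism h.
  split=> [|a b]; first by rewrite -(rmorph1 hyp_pi) hF /F rmorph1.
  have [p ->] := hyp_piP a; have [q ->] := hyp_piP b.
  by rewrite -rmorphM !hF /F rmorphM.
pose hh : {rmorphism A -> S} := HB.pack h
  (GRing.isZmodMorphism.Build A S h hzmod)
  (GRing.isMonoidMorphism.Build A S h hmon).
exists hh; split=> [c|i|||]; rewrite /= ?hF.
- by rewrite -hyp_piC hF /F mmapC.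
- exact: pointX.
- exact: pointR.
- exact: pointR.
- exact: pointR.
Qed.

(* The equation survives X_i := 0: evaluating at X = 0 and Y = 0 turns it into
   - (a0 + a1 T), which is nonzero. *)
Lemma hyp_x_reg i (a : A) : px i * a = 0 -> a = 0.
Proof.
have [q ->] := hyp_piP a; rewrite -rmorphM => /hyp_pi_eq0[c ec].
(* [s] sets $X_i=0$. Applied to $X_iq=cF$, with $F$ the equation, it gives $s(c)s(F)=0$. Once
   $s(F)\neq0$ is known, $s(c)=0$, so $X_i$ divides $c$ and cancels, which puts $q$ in the ideal. *)
pose s : P -> P := mmap (@mpolyC _ k) (point (upd vX i 0) vY vZ vT).
have sX j : s (vX j) = upd vX i 0 j by exact: pointX.
have scongr p : congr_mod (vX i) p (s p).
  elim/P_ind: p => [b|p p' hp hp'|p p' hp hp'|j|||].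
  - by rewrite /s mmapC; exact: congr_mod_refl.
  - by rewrite /s rmorphD; exact: congr_modD.
  - by rewrite /s rmorphM; exact: congr_modM.
  - rewrite sX /upd; case: eqP => [->|_]; last exact: congr_mod_refl.
    by exists 1; rewrite add0r mulr1.
  - by rewrite /s pointR; exact: congr_mod_refl.
  - by rewrite /s pointR; exact: congr_mod_refl.
  - by rewrite /s pointR; exact: congr_mod_refl.
have se0 : s (hyp_eqn r H) != 0.
  pose tau : P -> {poly {poly k}} :=
    mmap (polyC \o polyC) (point (fun=> 0) 0 'X%:P 'X).
  have tauc p : tau (s p) = tau p.
    elim/P_ind: p => [b|p p' hp hp'|p p' hp hp'|j|||].
    - by rewrite /s mmapC.
    - by rewrite /s /tau !rmorphD /= -/s -/tau hp hp'.
    - by rewrite /s /tau !rmorphM /= -/s -/tau hp hp'.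
    - rewrite sX /upd; case: eqP => // ->.
      by rewrite [RHS]pointX; exact: rmorph0.
    - by rewrite /s pointR.
    - by rewrite /s pointR.
    - by rewrite /s pointR.
  apply: contra_neq ha => /(congr1 tau); rewrite tauc /tau mmap_point_eqn.
  rewrite mulr0 sub0r rmorph0 => /eqP; rewrite oppr_eq0 => /eqP <-.
  have eC b : ev (polyC \o polyC) (fun=> 0 : {poly {poly k}}) 'X%:P
      (map_poly (@mpolyC m k) b) = b%:P.
    elim/poly_ind: b => [|b d IHb]; first by rewrite !rmorph0.
    by rewrite !(rmorphD, rmorphM) /= IHb map_polyX evZ map_polyC evCC.
  rewrite /l /g rmorphD /= !eC; congr (_ + _ * _).
  (* $\widetilde H$ vanishes at $X=0$, being in the ideal generated by the $X_i$. *)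
  rewrite -[LHS]addr0; congr (_ + _); apply/esym.
  apply: (rmorph_ideal_gen _ hHt).
  by move=> _ /mapP[j _ ->]; exact: evX.
have sc : s c = 0.
  apply/eqP; have /eqP := congr1 s ec; rewrite /s !rmorphM /= -/s sX upd_eq.
  by rewrite mul0r eq_sym mulf_eq0 (negPf se0) orbF.
have [c' ec'] := scongr c; rewrite sc add0r in ec'.
apply/hyp_pi_eq0; exists c'; apply: (@mulfI _ (vX i)).
  by rewrite -msize_poly_eq0 msizeX.
by rewrite ec ec' mulrA.
Qed.

Lemma hyp_D_reg N (a : A) : (\prod_i px i ^+ r i) ^+ N * a = 0 -> a = 0.
Proof.
have XN i n (b : A) : px i ^+ n * b = 0 -> b = 0.
  elim: n b => [b|n IHn b]; first by rewrite expr0 mul1r.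
  by rewrite exprS -mulrA => /hyp_x_reg/IHn.
elim: N a => [a|N IHN a]; first by rewrite expr0 mul1r.
rewrite exprS -mulrA => h; apply: IHN; move: (_ * a) h => b.
elim: (index_enum _) b => [|i s IHs] b; first by rewrite big_nil mul1r.
by rewrite big_cons -mulrA => /XN/IHs.
Qed.

(** $Y\mapsto(g+lT)/X^r$ maps $A$ to the fraction field of $C[Z][T]$ and extends the inclusion of
    $C[Z]$, hence freeness. It is injective: a power of $X^r$ takes an element of the kernel to a
    polynomial with zero image, which is 0, and $X^r$ is regular in $A$. *)
Lemma hyp_alg_hypersurface :
  hypersurface r g l px (hyp_pi vY) (hyp_pi vZ) (hyp_pi vT).
Proof.
pose R := {poly {poly {mpoly k[m]}}}; pose L := {fraction R}.
pose e : {rmorphism {poly {mpoly k[m]}} -> L} := @tofrac R \o polyC.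
pose f : {rmorphism k -> L} := e \o (polyC \o @mpolyC m k).
pose x' i : L := e ('X_i)%:P; pose z' : L := e 'X.
have eE p : ev f x' z' p = e p.
  rewrite -[in RHS](ev_id p).
  by apply/esym/(@rmorph_ev _ _ _ _ (polyC \o @mpolyC m k) e f).
have D'0 : \prod_i x' i ^+ r i != 0.
  apply/prodf_neq0 => i _; apply: expf_neq0; rewrite tofrac_eq0 !polyC_eq0.
  by rewrite -msize_poly_eq0 msizeX.
pose y' := (\prod_i x' i ^+ r i)^-1 * (ev f x' z' g + ev f x' z' l * tofrac 'X).
have [|h [hc hx hy hz ht]] := @hyp_lift L f x' y' z' (tofrac 'X).
  by rewrite /y' mulVKf.
have hev p : h (ev (GRing.in_alg A) px (hyp_pi vZ) p) = e p.
  by rewrite -eE; apply: (@rmorph_ev _ _ _ _ (GRing.in_alg A) h f).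
split; [exact: hyp_eq|exact: hyp_ind|exact: hyp_lift| |].
  move=> p /(congr1 h); rewrite hev rmorph0 => /eqP.
  by rewrite tofrac_eq0 polyC_eq0 => /eqP.
exists L, h; apply/(raddf_inj (f := h)) => a ha0.
have [N [p ep]] := hs_denominator hyp_eq hyp_ind a.
have := @rmorph_horner_map _ _ _ _ h (@tofrac R) _ p hev ht.
rewrite -ep (rmorphM h) ha0 mulr0.
move/esym/eqP; rewrite tofrac_eq0 => /eqP p0; apply: (@hyp_D_reg N).
by rewrite ep p0 horner_map0.
Qed.

End Quotient.

(** * The case a1 = 0 *)

Section Transport.
Variables (k : fieldType) (A B : comAlgType k).
Variables (th : {rmorphism A -> B}) (th' : {rmorphism B -> A}).
Hypotheses (thC : forall c, th c%:A = c%:A) (th'C : forall c, th' c%:A = c%:A).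
Hypotheses (thK : cancel th th') (th'K : cancel th' th).

Lemma map_poly_XaY (p : {poly B}) :
  map_poly (map_poly th') (poly_XaY p) = poly_XaY (map_poly th' p).
Proof.
rewrite /poly_XaY map_comp_poly rmorphD /= map_polyX map_polyC /= map_polyX.
congr (_ \Po _); rewrite -!map_poly_comp; apply: eq_map_poly => b /=.
exact: map_polyC.
Qed.

Lemma EXP_transport (phi : alg_to_poly B) : EXP B phi ->
  exists phi' : alg_to_poly A,
    EXP A phi' /\ forall a, phi' a = map_poly th' (phi (th a)).
Proof.
move=> [phi0 phiU].
pose h : {rmorphism A -> {poly A}} := map_poly th' \o (phi \o th).
have hc c : h c%:A = c%:A%:P.
  by rewrite /h /= thC phi_alg map_polyC /= th'C.
exists (rmorph_alg_to_poly hc); split=> //; split=> a.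
  rewrite -[LHS]/((map_poly th' (phi (th a))).[0]) -(rmorph0 th') horner_map.
  by rewrite phi0 thK.
transitivity (map_poly h (map_poly th' (phi (th a)))) => //.
rewrite -map_poly_comp -[RHS]/(poly_XaY (map_poly th' (phi (th a)))).
rewrite -map_poly_XaY -phiU -map_poly_comp; apply: eq_map_poly => b /=.
by rewrite th'K.
Qed.

End Transport.

Lemma ev_taylor1 (k : comNzRingType) m (S : comNzRingType)
    (f : {rmorphism k -> S}) (x : 'I_m -> S) z e p :
  exists c, ev f x (z + e) p = ev f x z p + e * c.
Proof. exact: taylor1. Qed.

Lemma ev_taylor2 (k : comNzRingType) m (S : comNzRingType)
    (f : {rmorphism k -> S}) (x : 'I_m -> S) z e p :
  exists c, ev f x (z + e) p = ev f x z p + e * ev f x z p^`() + e ^+ 2 * c.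
Proof. by rewrite [in ev f x z p^`()]/ev -deriv_map; exact: taylor2. Qed.

(** * Danielewski's trick: lowering one exponent by 1 *)

Section Descent.
Variables (k : fieldType) (m : nat) (i : 'I_m) (r r' : 'I_m -> nat) (n : nat).
Hypotheses (ri : r i = n.+2) (r'i : r' i = n.+1).
Hypothesis rr' : forall j, j != i -> r' j = r j.
Variables (h a b : {poly {mpoly k[m]}}).
Hypothesis bezout : a * h + b * h^`() = 1.
Variables (A : comAlgType k) (x : 'I_m -> A) (y z t : A).
Hypothesis hA : hypersurface r h 0 x y z t.
Variables (B : comAlgType k) (x' : 'I_m -> B) (y' z' t' : B).
Hypothesis hB : hypersurface r' h 0 x' y' z' t'.

Local Notation inA := (GRing.in_alg A).
Local Notation inB := (GRing.in_alg B).

(** This is $X^r/X_i^2$, so that $X_i\rho=X^{r'}$ is the $d$ of the trick. *)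
Let rho (S : comNzRingType) (w : 'I_m -> S) : S :=
  w i ^+ n * \prod_(j | j != i) w j ^+ r j.

Lemma prod_r' (S : comNzRingType) (w : 'I_m -> S) :
  \prod_j w j ^+ r' j = w i * rho w.
Proof.
rewrite (bigD1 i) //= r'i exprS -mulrA; congr (_ * (_ * _)).
by apply: eq_bigr => j ji; rewrite rr'.
Qed.

Lemma prod_r (S : comNzRingType) (w : 'I_m -> S) :
  \prod_j w j ^+ r j = w i * (w i * rho w).
Proof. by rewrite (bigD1 i) //= ri !exprS -!mulrA. Qed.

Lemma ev_bezout (S : comNzRingType) (f : {rmorphism k -> S}) w s :
  ev f w s a * ev f w s h + ev f w s b * ev f w s h^`() = 1.
Proof. by rewrite -!rmorphM -rmorphD bezout rmorph1. Qed.

Lemma hs_eqA : x i * (x i * rho x) * y = ev inA x z h.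
Proof. by rewrite -prod_r (hs_eq hA) rmorph0 mul0r addr0. Qed.

Lemma hs_eqB : x' i * rho x' * y' = ev inB x' z' h.
Proof. by rewrite -prod_r' (hs_eq hB) rmorph0 mul0r addr0. Qed.

(** In [B] put $T=b\,y'+x'_it'$ and expand $h(z'-dT)$ to second order. Its terms in $y'$ are
    $d\,y'(1-bh_Z)=d\,y'\,ah=a\,d^2y'^2$, so the whole is divisible by $x'_id=X^r$, and the quotient
    [Y] is the image of [y]. *)
Lemma descent_to : exists th : {rmorphism A -> B},
  [/\ forall c, th c%:A = c%:A, forall j, th (x j) = x' j,
      th t = ev inB x' z' b * y' + x' i * t' &
      th z = z' - x' i * rho x' * th t].
Proof.
pose T := ev inB x' z' b * y' + x' i * t'; pose p := x' i * rho x'.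
have [G eG] := ev_taylor2 inB x' z' (- (p * T)) h.
pose Y := ev inB x' z' a * rho x' * y' ^+ 2 - t' * ev inB x' z' h^`()
  + rho x' * T ^+ 2 * G.
have [|th [thC thx thy thz tht]] :=
    hs_lift hA (f := inB) (x' := x') (y' := Y) (z' := z' - p * T) (t' := T).
  rewrite prod_r rmorph0 mul0r addr0 eG -hs_eqB.
  have e : ev inB x' z' a * (x' i * rho x' * y')
      - (1 - ev inB x' z' b * ev inB x' z' h^`()) = 0.
    by rewrite -(ev_bezout inB x' z') hs_eqB; ring.
  apply/eqP; rewrite -subr_eq0; apply/eqP.
  transitivity (p * y' * (ev inB x' z' a * (x' i * rho x' * y')
      - (1 - ev inB x' z' b * ev inB x' z' h^`()))); last by rewrite e mulr0.
  by rewrite /Y /T /p; ring.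
by exists th; split=> //; rewrite tht.
Qed.

(** With $s=z+dt$, [Y] is $h(s)/d$ and [V] is $(t-b(s)Y)/x_i$, both written out by Taylor expansion.
    The second division succeeds because $1-bh_Z=ah$ is a multiple of $x_i$. *)
Lemma descent_from : exists th' : {rmorphism B -> A},
  [/\ forall c, th' c%:A = c%:A, forall j, th' (x' j) = x j,
      th' z' = z + x i * rho x * t &
      ev inA x (th' z') b * th' y' + x i * th' t' = t].
Proof.
pose p := x i * rho x.
have [G eG] := ev_taylor2 inA x z (p * t) h.
have [b1 eb] := ev_taylor1 inA x z (p * t) b.
pose Y := x i * y + ev inA x z h^`() * t + p * t ^+ 2 * G.
pose V := ev inA x z a * p * y * t
  - ev inA x (z + p * t) b * (y + rho x * t ^+ 2 * G)
  - rho x * t * b1 * ev inA x z h^`() * t.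
have [|th' [thC thx thy thz tht]] :=
    hs_lift hB (f := inA) (x' := x) (y' := Y) (z' := z + p * t) (t' := V).
  rewrite prod_r' rmorph0 mul0r addr0 eG -hs_eqA /Y /p; ring.
exists th'; split=> //; rewrite thy thz tht.
have e : 1 - ev inA x z b * ev inA x z h^`()
    - ev inA x z a * (x i * (x i * rho x) * y) = 0.
  by rewrite -(ev_bezout inA x z) hs_eqA; ring.
apply/esym/eqP; rewrite -subr_eq0; apply/eqP.
transitivity (t * (1 - ev inA x z b * ev inA x z h^`()
    - ev inA x z a * (x i * (x i * rho x) * y))); last by rewrite e mulr0.
by rewrite /V /Y eb /p; ring.
Qed.

Lemma descent_EXP (phi : alg_to_poly B) : EXP B phi ->
  (forall j, j != i -> phi (x' j) = (x' j)%:P) -> (1 < size (phi (x' i)))%N ->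
  exists phi' : alg_to_poly A,
  [/\ EXP A phi', forall j, j != i -> phi' (x j) = (x j)%:P &
      (1 < size (phi' (x i)))%N].
Proof.
move=> Ephi ex si.
have [th [thC thx tht thz]] := descent_to.
have [th' [th'C th'x th'z th't]] := descent_from.
have [LA [iA iA_inj]] := hs_domain hA; have [LB [iB iB_inj]] := hs_domain hB.
have th'rho : th' (rho x') = rho x.
  rewrite /rho rmorphM rmorphXn rmorph_prod /= th'x; congr (_ * _).
  by apply: eq_bigr => j _; rewrite rmorphXn /= th'x.
have throh : th (rho x) = rho x'.
  rewrite /rho rmorphM rmorphXn rmorph_prod /= thx; congr (_ * _).
  by apply: eq_bigr => j _; rewrite rmorphXn /= thx.
have th'pi : th' (x' i * rho x') = x i * rho x by rewrite rmorphM th'rho th'x.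
have thpi : th (x i * rho x) = x' i * rho x' by rewrite rmorphM throh thx.
have ev_th p w : th (ev inA x w p) = ev inB x' (th w) p by exact: rmorph_ev.
have ev_th' p w : th' (ev inB x' w p) = ev inA x (th' w) p by exact: rmorph_ev.
have Kt : th' (th t) = t.
  by rewrite tht rmorphD !rmorphM /= ev_th' th'x.
have Kz : th' (th z) = z.
  by rewrite thz rmorphB (rmorphM th' (_ * _)) Kt th'pi th'z addrK.
(* For [y], and below for [y'] and [t'], the identity is checked after multiplying by a nonzero
   element that brings in a defining relation. *)
have Ky : th' (th y) = y.
  apply: (inj_mulfI iA_inj (hs_D_neq0 hA)); rewrite prod_r.
  transitivity (th' (th (x i * (x i * rho x) * y))).
    rewrite (rmorphM th) (rmorphM th (x i)) thpi.
    by rewrite (rmorphM th') (rmorphM th' (th _)) thx th'x th'pi.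
  by rewrite hs_eqA ev_th ev_th' Kz.
have thK : cancel th th'.
  apply: (hs_ext hA (h := th' \o th) (h' := idfun)) => //= [c|j].
    by rewrite thC.
  by rewrite thx.
have Kz' : th (th' z') = z'.
  by rewrite th'z rmorphD (rmorphM th (_ * _)) thz thpi subrK.
have Ky' : th (th' y') = y'.
  apply: (inj_mulfI iB_inj (hs_D_neq0 hB)); rewrite prod_r'.
  transitivity (th (th' (x' i * rho x' * y'))).
    by rewrite (rmorphM th') (rmorphM th) th'pi thpi.
  by rewrite hs_eqB ev_th' ev_th Kz'.
have Kt' : th (th' t') = t'.
  apply: (inj_mulfI iB_inj (hs_x_neq0 hB i)).
  have /(congr1 th) := th't; rewrite rmorphD !rmorphM /= ev_th Kz' Ky' thx tht.
  exact: addrI.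
have th'K : cancel th' th.
  apply: (hs_ext hB (h := th \o th') (h' := idfun)) => //= [c|j].
    by rewrite th'C.
  by rewrite th'x.
have [phi' [Ephi' ephi']] := EXP_transport thC th'C thK th'K Ephi.
exists phi'; split=> // [j ji|]; rewrite ephi' thx.
  by rewrite ex // map_polyC /= th'x.
by rewrite size_map_inj_poly ?rmorph0 //; exact: can_inj th'K.
Qed.

End Descent.

(** * An exponential map moving $X_i$ when $r_i=1$ *)

Section BaseCase.
Variables (k : fieldType) (m : nat) (i : 'I_m) (r : 'I_m -> nat).
Hypothesis ri : r i = 1%N.
Variable h : {poly {mpoly k[m]}}.
Hypotheses (h_monic : h \is monic) (h_size : (1 < size h)%N).
Variables (A : comAlgType k) (x : 'I_m -> A) (y z t : A).
Hypothesis hA : hypersurface r h 0 x y z t.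

Local Notation inA := (GRing.in_alg A).
Local Notation inAU := (polyC \o GRing.in_alg A).

(** Otherwise $X_i$ would divide [h], and its leading coefficient 1 would vanish at $X=0$. *)
Lemma restr0_neq0 : restr0 i h != 0.
Proof.
have [h1 eh] := restr0_congr i h; apply/eqP => h0; move: eh; rewrite h0 add0r.
move/(congr1 (fun p : {poly {mpoly k[m]}} => p`_(size h).-1)).
rewrite coefCM -lead_coefE (monicP h_monic) => /(congr1 (meval (fun=> 0))).
by rewrite meval1 mevalM mevalXU mul0r => /eqP; rewrite oner_eq0.
Qed.

Lemma base_EXP : exists phi : alg_to_poly A,
  [/\ EXP A phi, forall j, j != i -> phi (x j) = (x j)%:P &
      (1 < size (phi (x i)))%N].
Proof.
have [L [iota iota_inj]] := hs_domain hA.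
pose X' (S : comNzRingType) (w : 'I_m -> S) := \prod_(j | j != i) w j ^+ r j.
have prodE (S : comNzRingType) (w : 'I_m -> S) :
    \prod_j w j ^+ r j = w i * X' S w.
  by rewrite (bigD1 i) //= ri expr1.
have X'0 : X' A x != 0.
  apply: (inj_prodf_neq0 iota_inj) => j _.
  exact/(inj_expf_neq0 iota_inj)/(hs_x_neq0 hA).
have [h1 eh] := restr0_congr i h.
pose u := X' A x * y - ev inA x z h1.
have eA : x i * X' A x * y = ev inA x z h.
  by rewrite -prodE (hs_eq hA) rmorph0 mul0r addr0.
(* [q0] is $h_0$ as a polynomial in $Z$ over [A]. *)
pose q0 := map_poly (mmap inA (upd x i 0)) h.
have xu : x i * u = q0.[z].
  rewrite -[RHS]/(ev inA (upd x i 0) z h) -ev_restr0 /u mulrBr mulrA eA.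
  by rewrite [in LHS]eh rmorphD rmorphM /= evX addrK.
have u0 : u != 0.
  apply: contraNneq (hs_ev_neq0 hA restr0_neq0) => u0.
  by rewrite ev_restr0 -[ev _ _ _ _]/(q0.[z]) -xu u0 mulr0.
have uX0 : u * X' A x != 0 by exact: (inj_mulf_neq0 iota_inj).
pose e : {poly A} := (u * X' A x)%:P * 'X; pose z' := z%:P + e.
have q0U w : ev inAU (upd (polyC \o x) i 0) w h = (map_poly polyC q0).[w].
  rewrite /ev /q0 -map_poly_comp; congr (_.[_]); apply: eq_map_poly => p /=.
  rewrite -(evC inA _ 0) -(evC inAU _ 0).
  apply/esym/(@rmorph_ev _ _ _ _ inA polyC inAU) => // j.
  by rewrite /upd; case: (j == i); rewrite ?rmorph0.
(* $h_0(z+uX'U)=x_iu+uX'Uc$; removing the factor $u$ gives the image $x_i+X'Uc$ of $x_i$. *)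
have [c ec] := taylor1 (map_poly polyC q0) z%:P e.
rewrite horner_map /= -xu in ec.
pose x' := upd (polyC \o x) i ((x i)%:P + (X' A x)%:P * 'X * c).
have x'i : x' i = (x i)%:P + (X' A x)%:P * 'X * c by rewrite /x' upd_eq.
have x'j j : j != i -> x' j = (x j)%:P by move=> ji; rewrite /x' upd_neq.
(* $x_i$ and $z$ move by multiples of $X'$, hence so does $h_1$; $Y\mapsto Y+c_1$ then keeps
   $u=X'Y-h_1$ fixed. *)
have [c1 ec1] : congr_mod (X' A x)%:P (ev inAU x' z' h1) (ev inA x z h1)%:P.
  rewrite -ev_polyC; apply: ev_congr => [j|].
    rewrite /x' /upd; case: eqP => [->|_]; last exact: congr_mod_refl.
    by exists ('X * c); rewrite mulrA.
  by exists (u%:P * 'X); rewrite /z' /e polyCM; congr (_ + _); ring.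
have eX' : X' _ x' = (X' A x)%:P.
  by rewrite rmorph_prod; apply: eq_bigr => j ji; rewrite rmorphXn /= x'j.
have eu : (X' A x)%:P * (y%:P + c1) - ev inAU x' z' h1 = u%:P.
  by rewrite ec1 /u polyCB polyCM; ring.
have ex'u : x' i * u%:P = ev inAU x' z' (restr0 i h).
  have -> : ev inAU x' z' (restr0 i h) = (map_poly polyC q0).[z'].
    rewrite ev_restr0 -q0U; apply: eq_ev => j.
    by rewrite /x' /upd; case: (j == i).
  by rewrite x'i /z' ec /e !polyCM; ring.
have [|phi [ex ey ez et]] := hs_lift_poly hA (x' := x') (y' := y%:P + c1)
    (z' := z') (t' := t%:P).
  rewrite prodE rmorph0 mul0r addr0 eX' [in RHS]eh rmorphD rmorphM /= evX.
  by rewrite -ex'u -mulrDr -eu subrK mulrA.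
have phiX' : phi (X' A x) = (X' A x)%:P.
  rewrite !rmorph_prod; apply: eq_bigr => j ji.
  by rewrite !rmorphXn /= ex x'j.
have phiu : phi u = u%:P.
  rewrite /u rmorphB rmorphM /= phiX' ey.
  rewrite (@rmorph_ev _ _ _ _ inA phi inAU x z x' z') // => d.
  exact: phi_alg.
have hz : expat phi z.
  apply: (expat_shift (d := u * X' A x)); first by rewrite ez.
  by rewrite rmorphM /= phiX' phiu -polyCM.
have hx0 j : expat phi (upd x i 0 j).
  apply: expat_const; rewrite /upd; case: eqP => [_|/eqP ji].
    by rewrite !rmorph0.
  by rewrite ex x'j.
have hx j : expat phi (x j).
  have [->|ji] := eqVneq j i; last by rewrite -(upd_neq x 0 ji); exact: hx0.
  (* $u$ is fixed, and $u x_i=h_0(z)$ involves only $z$ and the fixed $x_j$ with $j\neq i$. *)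
  apply: (expat_div iota_inj u0); first exact: expat_const.
  rewrite mulrC xu -[q0.[z]]/(ev inA (upd x i 0) z h).
  exact: (expat_ev _ hx0 hz).
have Ephi : EXP A phi.
  apply: (hs_EXP hA hx hz); first exact: expat_const.
  apply: (expat_div iota_inj (hs_D_neq0 hA)).
    by apply: expat_prod => j _; exact: (expatX _ (hx j)).
  by rewrite prodE eA; exact: (expat_ev _ hx hz).
exists phi; split=> // [j ji|]; first by rewrite ex x'j.
(* Otherwise x_i u is constant, and so would be h0(z + u X' U), of degree
   deg h in U. *)
rewrite ltnNge; apply/negP => /size1_polyC exi.
have {}exi : phi (x i) = (x i)%:P.
  by have [e0 _] := hx i; move: exi; rewrite -horner_coef0 e0.
have : (q0 - (x i * u)%:P) \Po z' = 0.
  rewrite comp_polyB comp_polyC /comp_poly -q0U polyCM -exi ex ex'u ev_restr0.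
  apply/eqP; rewrite subr_eq0; apply/eqP/eq_ev => j.
  by rewrite /x' /upd; case: (j == i).
move/(comp_poly_inj_eq0 iota_inj (size_shift z uX0))/eqP; rewrite subr_eq0.
move=> /eqP /(congr1 (fun p : {poly A} => size p)).
rewrite size_map_poly_id0 ?(monicP h_monic) ?rmorph1 ?oner_neq0 //.
by move=> eh'; move: h_size; rewrite eh' ltnNge size_polyC leq_b1.
Qed.

End BaseCase.

(** * Moving every $X_i$ when $a_1=0$ *)

Section EtaleCase.
Variables (k : fieldType) (m : nat) (a0 : {poly k}).
Variables (h : {poly {mpoly k[m]}}) (Ht : {poly {mpoly k[m]}}).
Hypothesis eh : h = map_poly (@mpolyC m k) a0 + Ht.
Hypothesis a0_neq0 : a0 != 0.
Hypothesis hHt : ideal_gen [seq ('X_i)%:P | i : 'I_m] Ht.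
Hypotheses (h_monic : h \is monic) (h_size : (1 < size h)%N).
Variables a b : {poly {mpoly k[m]}}.
Hypothesis bezout : a * h + b * h^`() = 1.

Lemma etale_hypersurface (r : 'I_m -> nat) :
  let pi := @hyp_pi k m r h%:P in
  hypersurface r h 0 (fun i => pi (@varX k m i)) (pi (varY k m)) (pi (varZ k m))
    (pi (varT k m)).
Proof.
rewrite /= [in hypersurface r h]eh -(rmorph0 (map_poly (@mpolyC m k))).
apply: hyp_alg_hypersurface => //.
  by rewrite rmorph0 mul0r addr0 eh.
by rewrite mul0r addr0 polyC_eq0.
Qed.

(** Induction on $r_i$ with [r] generalised, as each descent step changes the algebra; the other
    exponents and [h] stay the same. *)
Lemma etale_moves (r : 'I_m -> nat) i : (0 < r i)%N ->
  let x j := hyp_pi r h%:P (@varX k m j) in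
  exists phi : alg_to_poly (hyp_alg r h%:P),
  [/\ EXP _ phi, forall j, j != i -> phi (x j) = (x j)%:P &
      (1 < size (phi (x i)))%N].
Proof.
case rin: (r i) => [//|n] _; elim: n r rin => [|n IHn] r rin.
  exact: (base_EXP rin h_monic h_size (etale_hypersurface r)).
pose r' j := if j == i then n.+1 else r j.
have r'i : r' i = n.+1 by rewrite /r' eqxx.
have [phi [Ephi ex si]] := IHn r' r'i.
apply: (descent_EXP rin r'i _ bezout (etale_hypersurface r)
  (etale_hypersurface r') Ephi ex si) => j /negPf ji.
by rewrite /r' ji.
Qed.

End EtaleCase.

(** The right side is free of [x], which is what [exp_x] asks of $l=a_1(Z)$. *)
Lemma ev_map_mpolyC (k S : comNzRingType) m (f : {rmorphism k -> S})
    (x : 'I_m -> S) z (a : {poly k}) :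
  ev f x z (map_poly (@mpolyC m k) a) = (map_poly f a).[z].
Proof.
rewrite /ev -map_poly_comp; congr (_.[_]); apply: eq_map_poly => c.
exact: mmapC.
Qed.

Theorem proposition4p9 (k : fieldType) (m : nat) (hm : (1 <= m)%N)
    (r : 'I_m -> nat) (hr : forall i, (1 < r i)%N)
    (a0 a1 : {poly k}) (Ht : {poly {mpoly k[m]}})
    (H : {poly {poly {mpoly k[m]}}})
    (hH : H = (map_poly (@mpolyC m k) a0)%:P
              + (map_poly (@mpolyC m k) a1)%:P * 'X + Ht%:P)
    (ha : a0%:P + a1%:P * 'X != 0 :> {poly {poly k}})
    (hHt : ideal_gen [seq ('X_i)%:P | i : 'I_m] Ht) :
    (a1 != 0
     \/ (a1 = 0 /\ exists h : {poly {mpoly k[m]}},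
           [/\ H = h%:P, h \is monic, (1 < size h)%N &
               ideal_gen [:: h; h^`()] = [set: {poly {mpoly k[m]}}]])) ->
  DK (hyp_alg r H) = [set: hyp_alg r H] /\
  ML (hyp_alg r H) = range (GRing.in_alg (hyp_alg r H)).
Proof.
case=> [a1_neq0|[a1_0 [h [eH h_monic h_size h_ideal]]]].
  have l_neq0 : map_poly (@mpolyC m k) a1 != 0 by rewrite map_poly_eq0.
  have hH' : H = (map_poly (@mpolyC m k) a0 + Ht)%:P
      + (map_poly (@mpolyC m k) a1)%:P * 'X.
    by rewrite hH polyCD addrAC.
  have hA : hypersurface r (map_poly (@mpolyC m k) a0 + Ht)
      (map_poly (@mpolyC m k) a1) _ _ _ _ :=
    hyp_alg_hypersurface r hH' ha hHt.
  have moves i := exp_x hA i l_neq0 (fun S f x' x'' z' =>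
    etrans (ev_map_mpolyC f x' z' a1) (esym (ev_map_mpolyC f x'' z' a1))).
  have lz0 := hs_ev_neq0 hA l_neq0.
  split; [apply: (hs_DK hA)|apply: (hs_ML hA) => i].
    (* Any index will do, and $m\geq1$ provides one. *)
    have [phi [Ephi _ ex _ ey]] := moves (Ordinal hm).
    by exists phi; split=> //; exact: (invariants_neqT ex).
  have [phi [Ephi exj exi _ _]] := moves i.
  by exists phi; split=> //; rewrite exi; exact: size_shift.
have eh : h = map_poly (@mpolyC m k) a0 + Ht.
  apply: polyC_inj; rewrite -eH hH a1_0 rmorph0 polyC0 mul0r addr0.
  exact/esym/polyCD.
have a0_neq0 : a0 != 0 by move: ha; rewrite a1_0 mul0r addr0 polyC_eq0.
have [c bezout] : ideal_gen [:: h; h^`()] 1 by rewrite h_ideal.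
move: bezout; rewrite !big_ord_recl big_ord0 addr0 /= => /esym bezout.
rewrite eH; have hA := etale_hypersurface eh a0_neq0 hHt r.
split; [apply: (hs_DK hA)|apply: (hs_ML hA) => i].
  (* The shift of $T$ sends $y$ to $y+lU$, which is $y$ since $l=0$. *)
  have [phi [Ephi _ _ et ey]] := exp_t hA.
  exists phi; split=> //; last exact: (invariants_neqT et (hs_D_neq0 hA)).
  by rewrite /invariants /= ey rmorph0 mul0r addr0.
exact: (etale_moves eh a0_neq0 hHt h_monic h_size bezout (ltnW (hr i))).
Qed.
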